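(* Let $\Gamma$ be a reduced nonbipartite graph of diameter $2$ which contains no triangles. Then $\Gamma$ is stable.
   Context: Graphs are finite, simple, loopless; reduced means distinct vertices have distinct neighbourhoods. The diameter of a connected graph is the maximum shortest-path distance between two vertices. The canonical double cover $\mathrm{B}\Gamma=\Gamma\times K_2$ has vertex set $V\times\{0,1\}$ with $(u,i)\sim(v,j)$ iff $(u,v)\in E$ and $i\ne j$. $\Gamma$ is stable if $\mathrm{Aut}(\mathrm{B}\Gamma)\cong\mathrm{Aut}(\Gamma)\times\mathbb{Z}_2$. *)

(* Defs.v *)
(* A finite simple graph is a symmetric irreflexive [e : rel T] on
   [T : finType]. *)
From mathcomp Require Import all_boot all_fingroup zmodp.

Set Implicit Arguments.
Unset Strict Implicit.
Unset Printing Implicit Defensive.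

Section Graph.
Variables (T : finType) (e : rel T).

Definition neighbours (x : T) : {set T} := [set y | e x y].

Definition reduced : Prop := injective neighbours.

Definition bipartite : Prop :=
  exists c : T -> bool, forall x y, e x y -> c x != c y.

Definition triangle_free : Prop :=
  forall x y z, ~~ [&& e x y, e y z & e z x].

Definition connected : Prop := forall x y, connect e x y.

Definition walk_of_length (x y : T) (n : nat) : bool :=
  [exists p : n.-tuple T, path e x p && (last x p == y)].

(* A shortest path has fewer than #|T| edges, so the search below finds its
   length whenever x and y are connected; the junk value is #|T| otherwise. *)
Definition dist (x y : T) : nat := find (walk_of_length x y) (iota 0 #|T|).

Definition diameter : nat := \max_(x : T) \max_(y : T) dist x y.

Definition graph_aut : {set {perm T}} :=
  [set s : {perm T} | [forall x, forall y, e (s x) (s y) == e x y]].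

Lemma graph_aut_group_set : group_set graph_aut.
Proof.
apply/group_setP; split=> [|s t].
  by rewrite inE; apply/'forall_'forall_eqP=> x y; rewrite !perm1.
rewrite !inE => /'forall_'forall_eqP hs /'forall_'forall_eqP ht.
by apply/'forall_'forall_eqP=> x y; rewrite !permM ht hs.
Qed.

Canonical graph_aut_group := Group graph_aut_group_set.

Definition double_cover : rel (T * bool) :=
  fun u v => e u.1 v.1 && (u.2 != v.2).

End Graph.

(* ['Z_2] carries its additive group structure. *)
Definition stable (T : finType) (e : rel T) : Prop :=
  graph_aut (double_cover e) \isog setX (graph_aut e) [set: 'Z_2].

(* Main.v *)
(* In a triangle-free graph of diameter at most 2, two distinct vertices are
   adjacent exactly when they have no common neighbour. An automorphism of the
   double cover of a connected nonbipartite graph preserves or swaps the two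
   layers, hence acts on them by permutations a and b with
   e (a x) (b y) = e x y. Such an a preserves having a common neighbour, hence
   preserves adjacency; then a y and b y have the same neighbours, so a = b in
   a reduced graph. *)
Require Import Defs.
From mathcomp Require Import all_boot all_fingroup zmodp.

Set Implicit Arguments.
Unset Strict Implicit.
Unset Printing Implicit Defensive.

(** A path without repeated vertices has fewer than [#|T|] edges, so the search defining [dist]
    succeeds and does not return its junk value. *)
Lemma walk_dist (T : finType) (e : rel T) (x y : T) :
  connect e x y -> walk_of_length e x y (dist e x y).
Proof.
case/connectP=> p0 /shortenP[p ep up _] y_last.
have lt_p : size p < #|T| by have /= <- := card_uniqP up; apply: max_card.
have has_walk : has (walk_of_length e x y) (iota 0 #|T|).
  apply/hasP; exists (size p); first by rewrite mem_iota.
  by apply/existsP; exists (in_tuple p); rewrite ep y_last /=.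
have := nth_find 0 has_walk.
by rewrite nth_iota // -[X in _ < X](size_iota 0) -has_find.
Qed.

Lemma dist_le_diameter (T : finType) (e : rel T) (x y : T) :
  dist e x y <= diameter e.
Proof.
by rewrite /diameter (bigD1 x) //= (bigD1 y) //= -maxnA leq_maxl.
Qed.

Lemma connected_invariant (T : finType) (e : rel T) (U : Type) (f : T -> U) :
  connected e -> (forall x y, e x y -> f x = f y) -> forall x y, f x = f y.
Proof.
move=> e_conn fE x y; have /connectP[p] := e_conn x y.
elim: p x => [|z p IHp] x /=; first by move=> _ ->.
by case/andP=> /fE -> ep; apply: IHp.
Qed.

Section DoubleCover.

Variables (T : finType) (e : rel T).

(** A common neighbour of adjacent vertices would close a triangle. Conversely, for distinct
    nonadjacent vertices the walk realising [dist] can only have length 2, and its midpoint is a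
    common neighbour. *)
Lemma adjacent_common_neighbour :
  symmetric e -> connected e -> diameter e <= 2 -> triangle_free e ->
  irreflexive e ->
  forall x y, e x y = (x != y) && ~~ [exists z, e x z && e y z].
Proof.
move=> e_sym e_conn e_diam e_tri e_irr x y; apply/idP/andP=> [exy|[neq_xy]].
  split; first by apply: contraTneq exy => ->; rewrite e_irr.
  apply/existsPn=> z; have := e_tri x y z.
  by rewrite exy [e z x]e_sym /= andbC.
apply: contraR => nexy.
have := leq_trans (dist_le_diameter e x y) e_diam.
have := walk_dist (e_conn x y).
case: (dist e x y) => [|[|[|//]]] /existsP[[p size_p]] /= /andP[].
- by case: p size_p => //= _ _; rewrite (negPf neq_xy).
- case: p size_p => [|z []] //= _; rewrite andbT => exz /eqP zy.
  by rewrite -zy exz in nexy.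
case: p size_p => [|z [|w []]] //= _ /and3P[exz ezw _] /eqP wy _.
by apply/existsP; exists z; rewrite exz e_sym -wy.
Qed.

Lemma twofold_automorphism_diagonal (a b : T -> T) :
  reduced e ->
  (forall x y, e x y = (x != y) && ~~ [exists z, e x z && e y z]) ->
  injective a -> injective b ->
  (forall x y, e (a x) (b y) = e x y) ->
  symmetric e ->
  a =1 b.
Proof.
move=> e_red adjE inj_a inj_b abE e_sym.
have aE x y : e (a x) (a y) = e x y.
  rewrite !adjE (inj_eq inj_a); congr (_ && ~~ _).
  (* Since [b] is bijective, [z] is a common neighbour of [x] and [y] exactly when [b z] is one of
     [a x] and [a y]. *)
  apply/existsP/existsP=> -[z].
    have [b' _ b'K] := injF_bij inj_b.
    by rewrite -(b'K z) !abE; exists (b' z).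
  by exists (b z); rewrite !abE.
have [a' _ a'K] := injF_bij inj_a.
move=> y; apply: e_red; apply/setP=> x.
by rewrite !inE -(a'K x) aE e_sym -abE e_sym.
Qed.

Lemma double_cover_aut_layer (s : {perm T * bool}) :
  connected e -> ~ bipartite e -> s \in graph_aut (double_cover e) ->
  exists c, forall x i, (s (x, i)).2 = i (+) c.
Proof.
move=> e_conn e_nonbip; rewrite inE => /'forall_'forall_eqP sE.
(* [f x i] tells whether [s] moves [(x, i)] to the other layer. It is constant along edges of the
   double cover, whose ends and their images lie in opposite layers. *)
pose f x i := (s (x, i)).2 (+) i.
have f_edge x y i : e x y -> f x i = f y (~~ i).
  move=> exy; have := sE (x, i) (y, ~~ i).
  rewrite /double_cover /= exy /= /f.
  by case: i (s (x, _)).2 (s (y, _)).2 => [] [] [] //=; rewrite ?andbF.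
have f_swap x y : f x true (+) f x false = f y true (+) f y false.
  apply: (connected_invariant (f := fun z => f z true (+) f z false) e_conn).
  by move=> {}x {}y exy; rewrite !(f_edge x y) //= addbC.
(* If the two values differ at one vertex, they differ at all by [f_swap], and then [f^~ true] is a
   proper 2-colouring. *)
have fE x : f x true = f x false.
  apply/eqP; apply: contra_notT e_nonbip; rewrite negb_eqb => fx.
  exists (f^~ true) => y z eyz.
  by rewrite (f_edge y z) //= eq_sym negb_eqb (f_swap z x).
have f_const : forall x y, f x false = f y false.
  apply: connected_invariant e_conn _ => x y exy.
  by rewrite (f_edge x y) //= fE.
have [x0 _|T0] := pickP T; last by exists false => x; have := T0 x.
exists (f x0 false) => x i; rewrite (f_const x0 x).
have -> : f x false = f x i by case: i; rewrite ?fE.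
by rewrite /f addbC addbK.
Qed.

(** [odd] identifies ['Z_2] with the layer bit, turning its addition into [(+)]. *)
Definition layer_map (a : {perm T} * 'Z_2) (u : T * bool) : T * bool :=
  (a.1 u.1, u.2 (+) odd a.2).

Lemma layer_map_inj a : injective (layer_map a).
Proof. by move=> [x i] [y j] [/perm_inj -> /addIb ->]. Qed.

Definition layer_perm a : {perm T * bool} := perm (@layer_map_inj a).

Lemma layer_permM : {morph layer_perm : a b / (a * b)%g >-> (a * b)%g}.
Proof.
move=> [a i] [b j]; apply/permP=> -[x k]; rewrite permM !permE /layer_map /=.
rewrite permM -addbA; congr (_, _ (+) _).
by case: i j => [[|[|//]] ?] [[|[|//]] ?].
Qed.

(** The vertex is essential: over an empty [T] both elements of ['Z_2] give the same permutation. *)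
Lemma layer_perm_inj : T -> injective layer_perm.
Proof.
move=> x0 [a i] [b j] /permP eq_ab; congr (_, _).
  by apply/permP=> x; have := eq_ab (x, false); rewrite !permE => -[].
have := eq_ab (x0, false); rewrite !permE => -[_].
by case: i j {eq_ab} => [[|[|//]] ?] [[|[|//]] ?] //= _; apply: val_inj.
Qed.

Lemma layer_perm_aut a :
  (layer_perm a \in graph_aut (double_cover e)) = (a.1 \in graph_aut e).
Proof.
rewrite !inE; apply/'forall_'forall_eqP/'forall_'forall_eqP=> aE.
  move=> x y; have := aE (x, false) (y, true).
  by rewrite !permE /double_cover /=; case: (odd _); rewrite !andbT.
move=> [x i] [y j]; rewrite !permE /double_cover /= aE.
by case: i j (odd _) => [] [] [].
Qed.

End DoubleCover.

Theorem theorem3p4 (T : finType) (e : rel T)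
    (e_sym : symmetric e) (e_irr : irreflexive e)
    (e_reduced : reduced e)
    (e_nonbip : ~ bipartite e)
    (e_conn : connected e)
    (e_diam : diameter e = 2)
    (e_trifree : triangle_free e) :
  stable e.
Proof.
(* An empty graph is bipartite; the vertex [x0] serves the injectivity of [layer_perm]. *)
have [x0 _|T0] := pickP T; last first.
  by case: e_nonbip; exists xpredT => x; have := T0 x.
rewrite /stable isog_sym; apply/isogP.
pose D := setX (graph_aut e) [set: 'Z_2].
have layerM : {in D &, {morph @layer_perm T : a b / (a * b)%g >-> (a * b)%g}}.
  by move=> a b _ _; apply: layer_permM.
exists (Morphism layerM).
  by apply/injmP=> a b _ _; apply: layer_perm_inj.
rewrite morphimEdom; apply/setP=> s; apply/imsetP/idP=> [[[a i]]|s_aut].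
  by rewrite inE => /andP[a_aut _] ->; rewrite layer_perm_aut.
have [c sc] := double_cover_aut_layer e_conn e_nonbip s_aut.
pose a i x := (s (x, i)).1.
have sE x i : s (x, i) = (a i x, i (+) c).
  by rewrite -(sc x) /a; case: (s _).
have a_inj i : injective (a i).
  move=> x y axy; suff /perm_inj[] : s (x, i) = s (y, i) by [].
  by rewrite !sE axy.
have aE : a false =1 a true.
  apply: (twofold_automorphism_diagonal e_reduced) => // [|x y].
    by apply: adjacent_common_neighbour; rewrite ?e_diam.
  move: s_aut; rewrite inE => /'forall_'forall_eqP/(_ (x, false) (y, true)).
  by rewrite !sE /double_cover /=; case: (c); rewrite !andbT.
(* The bit [c] as a residue modulo 2, so that [odd k] recovers [c]. *)
pose k : 'Z_2 := inZp c.
have s_layer : s = layer_perm (perm (a_inj false), k).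
  apply/permP=> -[x i]; rewrite sE permE /layer_map /= permE.
  by congr (_, _); [case: i | case: (c)].
exists (perm (a_inj false), k) => //.
by rewrite inE in_setT andbT -(layer_perm_aut e (_, k)) -s_layer.
Qed.
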